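(* Let $k$ be a field and let $I$ be a proper monomial ideal in the polynomial ring $R=k[x_1, \ldots, x_r, b_0, b_1]$. Fix a term order on $R$ with $b_0 > b_1$. Let $f \in R'=k[x_1,\ldots, x_r,b_1]\subseteq R$ be a polynomial. Then $f$ is regular on $R/(I,b_0+b_1)$ if and only if $f$ is initially regular on $R/(I, b_0+b_1)$.
   Context: $\mathfrak m$ is the ideal of $R$ generated by all the variables. A term order is a monomial order (a total order on monomials, compatible with multiplication, with $1$ smallest), and $\mathrm{in}(J)$ is the initial ideal of $J$ with respect to the fixed term order. An element $f$ is regular on $R/J$ if $f\in\mathfrak m$ and $f$ is a non-zerodivisor on $R/J$. A polynomial $f$ is initially regular on $R/J$ ($J$ a proper ideal) if $f$ is regular on $R/\mathrm{in}(J)$. *)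

(* Defs.v *)
From HB Require Import structures.
From mathcomp Require Import all_boot all_order all_algebra.
From mathcomp Require Export mpoly.

Set Implicit Arguments.
Unset Strict Implicit.
Unset Printing Implicit Defensive.

Import GRing.Theory.
Local Open Scope ring_scope.

(* Sets and ideals of polynomials are Prop-valued predicates, so that no
   decidability of ideal membership is assumed. *)

Section Ideals.
Variables (n : nat) (k : fieldType).
Implicit Types (S I J : {mpoly k[n]} -> Prop) (f p q : {mpoly k[n]}).

Definition ideal_gen S p : Prop :=
  exists2 s : seq ({mpoly k[n]} * {mpoly k[n]}),
    (forall c, c \in s -> S c.2) & p = \sum_(c <- s) c.1 * c.2.

Definition ideal_add I f : {mpoly k[n]} -> Prop :=
  ideal_gen (fun q => I q \/ q = f).

Definition monomial_ideal I : Prop :=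
  exists M : 'X_{1..n} -> Prop,
    forall p, I p <-> ideal_gen (fun q => exists2 m, M m & q = 'X_[m]) p.

Definition max_ideal : {mpoly k[n]} -> Prop :=
  ideal_gen (fun q => exists i : 'I_n, q = 'X_i).

(* [f] is regular on R/J; the second clause says that the class of [f] is not a
   zero divisor in R/J. *)
Definition regular_on J f : Prop :=
  max_ideal f /\ (forall g, J (f * g) -> J g).

End Ideals.

Record term_order (n : nat) (le : rel 'X_{1..n}) : Prop := TermOrder {
  term_order_total : total le;
  term_order_anti : antisymmetric le;
  term_order_trans : transitive le;
  term_order_mul : forall m m1 m2 : 'X_{1..n},
    le m1 m2 -> le (m + m1)%MM (m + m2)%MM;
  term_order_one : forall m : 'X_{1..n}, le 0%MM m
}.

Section Initial.
Variables (n : nat) (k : fieldType) (le : rel 'X_{1..n}).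
Implicit Types (J : {mpoly k[n]} -> Prop) (f p q : {mpoly k[n]}).

(* This forces [p != 0].  The library's [mlead] is tied to one specific
   monomial order, hence is not used. *)
Definition is_lead_mon p (m : 'X_{1..n}) : Prop :=
  m \in msupp p /\ (forall m', m' \in msupp p -> le m' m).

Definition initial_ideal J : {mpoly k[n]} -> Prop :=
  ideal_gen (fun q => exists p m, [/\ J p, is_lead_mon p m & q = 'X_[m]]).

Definition initially_regular_on J f : Prop :=
  regular_on (initial_ideal J) f.

End Initial.

(* k[x_1, ..., x_r, b_0, b_1] is {mpoly k[r.+2]} with b_1 at index r and b_0 at
   index r.+1, so that k[x_1, ..., x_r, b_1] is {mpoly k[r.+1]}, included in the
   former by [mwiden]. *)
Definition var_b0 (r : nat) : 'I_r.+2 := ord_max.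
Definition var_b1 (r : nat) : 'I_r.+2 := widen_ord (leqnSn r.+1) ord_max.

(* Main.v *)
From HB Require Import structures.
Require Import Defs.
From mathcomp Require Import all_boot all_order all_algebra.

(** Let [J = (I, b0 + b1)], let [phi] be the substitution [b0 := - b1] and [psi]
    the substitution [b0 := 0]. Modulo [b0 + b1 \in J] every polynomial is
    congruent to its image under [phi], and modulo [b0 \in in(J)] to its image
    under [psi]; both images are free of [b0]. Since [phi] sends monomials to
    signed monomials, [J] meets [k[x, b1]] in a monomial ideal. Since [b1 < b0],
    [phi] never increases a monomial, so it preserves a leading monomial free of
    [b0]. Hence [J] and [in(J)] have the same elements free of [b0], and
    as [f] is free of [b0], it is a zero divisor modulo [J] iff it is one
    modulo [in(J)]. *)

Set Implicit Arguments.
Unset Strict Implicit.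
Unset Printing Implicit Defensive.

Import GRing.Theory.
Local Open Scope ring_scope.

(** * Closure properties and induction for generated ideals *)

Section IdealGen.
Variables (n : nat) (k : fieldType).
Implicit Types (S : {mpoly k[n]} -> Prop) (p q c : {mpoly k[n]}).

Lemma ideal_gen_sub S p : S p -> ideal_gen S p.
Proof.
move=> Sp; exists [:: (1, p)]; last by rewrite big_seq1 mul1r.
by move=> c; rewrite inE => /eqP->.
Qed.

Lemma ideal_gen0 S : ideal_gen S 0.
Proof. by exists [::]; rewrite ?big_nil. Qed.

Lemma ideal_genD S p q : ideal_gen S p -> ideal_gen S q -> ideal_gen S (p + q).
Proof.
move=> [s Ss ->] [t St ->]; exists (s ++ t); last by rewrite big_cat.
by move=> c; rewrite mem_cat => /orP[/Ss|/St].
Qed.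

Lemma ideal_genM S c p : ideal_gen S p -> ideal_gen S (c * p).
Proof.
move=> [s Ss ->]; exists [seq (c * d.1, d.2) | d <- s].
  by move=> _ /mapP[d /Ss Sd ->].
by rewrite big_map mulr_sumr; apply: eq_bigr => d _; rewrite mulrA.
Qed.

Lemma ideal_genZ S a p : ideal_gen S p -> ideal_gen S (a *: p).
Proof. by rewrite -mul_mpolyC; apply: ideal_genM. Qed.

Lemma ideal_genB S p q : ideal_gen S p -> ideal_gen S q -> ideal_gen S (p - q).
Proof. by move=> Sp Sq; rewrite -mulN1r; apply/ideal_genD/ideal_genM. Qed.

Lemma ideal_gen_congr S p q :
  ideal_gen S (p - q) -> (ideal_gen S p <-> ideal_gen S q).
Proof.
move=> Spq; split=> [Sp | Sq]; last by rewrite -(subrK q p); apply: ideal_genD.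
by rewrite -(subKr p q); apply: ideal_genB.
Qed.

Lemma ideal_gen_ind S (P : {mpoly k[n]} -> Prop) :
    P 0 -> (forall p q, P p -> P q -> P (p + q)) ->
    (forall c p, P p -> P (c * p)) -> (forall p, S p -> P p) ->
  forall p, ideal_gen S p -> P p.
Proof.
move=> P0 PD PM PS _ [s Ss ->]; rewrite big_seq.
by elim/big_ind: _ => // d /Ss/PS; apply: PM.
Qed.

Lemma ideal_gen_msupp S p :
  (forall m, m \in msupp p -> ideal_gen S 'X_[m]) -> ideal_gen S p.
Proof.
move=> Sp; rewrite [p]mpolyE big_seq.
elim/big_ind: _ => [||m /Sp]; [exact: ideal_gen0 | exact: ideal_genD |].
exact: ideal_genZ.
Qed.

End IdealGen.

Section TermOrder.
Variables (n : nat) (le : rel 'X_{1..n}).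
Hypothesis leP : term_order le.

Lemma term_order_refl m : le m m.
Proof. by have := term_order_total leP m m; rewrite orbb. Qed.

Lemma term_order_mulm2r m m1 m2 : le m1 m2 -> le (m1 + m)%MM (m2 + m)%MM.
Proof. by rewrite ![(_ + m)%MM]addmC; apply: (term_order_mul leP). Qed.

Lemma term_order_muln m1 m2 e : le m1 m2 -> le (m1 *+ e)%MM (m2 *+ e)%MM.
Proof.
move=> le12; elim: e => [|e IHe]; first by rewrite !mulm0n term_order_refl.
rewrite !mulmS; apply: (term_order_trans leP) (term_order_mul leP _ IHe).
exact: term_order_mulm2r.
Qed.

End TermOrder.

(** * Substitution of a polynomial for a single variable *)

Section Substitution.
Variables (n : nat) (k : fieldType).
Implicit Types (i j : 'I_n) (u v p q : {mpoly k[n]}) (m : 'X_{1..n}).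

Definition subst_var i u : {mpoly k[n]} -> {mpoly k[n]} :=
  comp_mpoly [tuple if j == i then u else 'X_j | j < n].

HB.instance Definition _ i u := GRing.LRMorphism.on (subst_var i u).

Lemma subst_varXU i u j :
  subst_var i u 'X_j = if j == i then u else 'X_j.
Proof. by rewrite /subst_var comp_mpolyXU -tnth_nth tnth_mktuple. Qed.

Lemma mpoly_XU_ind (P : {mpoly k[n]} -> Prop) :
    (forall c, P c%:MP) -> (forall p q, P p -> P q -> P (p + q)) ->
    (forall p q, P p -> P q -> P (p * q)) -> (forall i, P 'X_i) ->
  forall p, P p.
Proof.
move=> PC PD PM PX p; rewrite [p]mpolyE.
elim/big_ind: _ => [||m _]; [by rewrite -mpolyC0 | exact: PD |].
rewrite -mul_mpolyC; apply: (PM) => //; rewrite mpolyXE_id.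
elim/big_ind: _ => [||i _]; [by rewrite -mpolyC1 | exact: PM |].
by elim: (m i) => [|e IHe]; rewrite ?expr0 -?mpolyC1 // exprS; apply: PM.
Qed.

Lemma subst_varC i u c : subst_var i u c%:MP = c%:MP.
Proof. exact: comp_mpolyC. Qed.

(** Substitution is a ring morphism, so the polynomials congruent to their image are closed under
    sums and products, and only the variables need checking. *)
Lemma subst_var_congr (S : {mpoly k[n]} -> Prop) i u p :
  ideal_gen S ('X_i - u) -> ideal_gen S (p - subst_var i u p).
Proof.
move=> Su; elim/mpoly_XU_ind: p => [c|p q Sp Sq|p q Sp Sq|j].
- by rewrite subst_varC subrr; apply: ideal_gen0.
- by rewrite rmorphD opprD addrACA; apply: ideal_genD.
- have -> : p * q - subst_var i u (p * q) =
      q * (p - subst_var i u p) + subst_var i u p * (q - subst_var i u q).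
    by rewrite rmorphM /= !mulrBr [q * p]mulrC [q * _]mulrC addrA subrK.
  by apply: ideal_genD; apply: ideal_genM.
- by rewrite subst_varXU; case: eqP => [-> //|_];
  rewrite subrr; apply: ideal_gen0.
Qed.

(** Allowing [u] and [v] to differ lets this show that [phi] and [psi] fix each other's images as
    well as their own. *)
Lemma subst_var_idem i u v p :
  subst_var i u v = v -> subst_var i u (subst_var i v p) = subst_var i v p.
Proof.
move=> uv; elim/mpoly_XU_ind: p => [c|p q IHp IHq|p q IHp IHq|j].
- by rewrite !subst_varC.
- by rewrite !rmorphD /= IHp IHq.
- by rewrite !rmorphM /= IHp IHq.
- by rewrite subst_varXU; case: ifP => // ji; rewrite subst_varXU ji.
Qed.

Lemma subst_varX i u m :
  subst_var i u 'X_[m] = 'X_[m - U_(i) *+ m i] * u ^+ m i.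
Proof.
rewrite /subst_var comp_mpolyX mpolyXE_id (bigD1 i) //= [in RHS](bigD1 i) //=.
rewrite tnth_mktuple eqxx mnmBE mulmnE mnm1E eqxx mul1n subnn expr0 mul1r.
rewrite mulrC; congr (_ * _); apply: eq_bigr => j ji.
by rewrite tnth_mktuple (negPf ji) mnmBE mulmnE mnm1E eq_sym (negPf ji) subn0.
Qed.

Lemma subst_varX_free i u m : m i = 0%N -> subst_var i u 'X_[m] = 'X_[m].
Proof. by move=> mi; rewrite subst_varX mi mulm0n subm0 mulr1. Qed.

Lemma subst_var0X i m : m i != 0%N -> subst_var i 0 'X_[m] = 0.
Proof. by rewrite subst_varX expr0n => /negPf->; rewrite mulr0. Qed.

(** The truncated subtraction loses nothing here: it clears the exponent at [i]. *)
Definition merge_var i j m : 'X_{1..n} :=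
  (m - U_(i) *+ m i + U_(j) *+ m i)%MM.

Lemma subst_varNX i j m :
  subst_var i (- 'X_j) 'X_[m] = (-1) ^+ m i *: 'X_[merge_var i j m].
Proof.
by rewrite subst_varX -scaleN1r exprZn mpolyXn -scalerAr -mpolyXD.
Qed.

End Substitution.

(** * Comparison of [J] with its initial ideal *)

Section TwoVariables.
Variables (n : nat) (k : fieldType) (b0 b1 : 'I_n) (le : rel 'X_{1..n}).
Hypotheses (leP : term_order le) (le_b1_b0 : le U_(b1)%MM U_(b0)%MM).
Hypothesis b1_neq_b0 : b1 != b0.
Variable I : {mpoly k[n]} -> Prop.
Hypothesis monI : monomial_ideal I.

Local Notation J := (ideal_add I ('X_b0 + 'X_b1)).
Local Notation inJ := (initial_ideal le J).
Local Notation phi := (@subst_var n k b0 (- 'X_b1)).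
Local Notation psi := (@subst_var n k b0 0).

Lemma le_merge_var m : le (merge_var b0 b1 m) m.
Proof.
have lem : (U_(b0) *+ m b0 <= m)%MM.
  apply/mnm_lepP => i; rewrite mulmnE mnm1E.
  by case: eqP => [<-|_]; rewrite ?mul1n.
(* Split [m] into its part free of [b0] and a power of [b0]; only the latter changes, into the same
   power of [b1]. *)
rewrite -[X in le _ X](submK lem); apply: (term_order_mul leP).
exact: term_order_muln.
Qed.

Lemma mem_phi p : J p <-> J (phi p).
Proof.
apply/ideal_gen_congr/subst_var_congr; rewrite opprK.
by apply: ideal_gen_sub; right.
Qed.

Lemma initial_b0 : inJ 'X_b0.
Proof.
apply: ideal_gen_sub; exists ('X_b0 + 'X_b1), U_(b0)%MM; split=> //.
  by apply: ideal_gen_sub; right.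
split=> [|m /msuppD_le].
  rewrite mcoeff_msupp mcoeffD !mcoeffXU eqxx (negPf b1_neq_b0) addr0.
  exact: oner_neq0.
rewrite mem_cat !msuppX !inE => /orP[] /eqP-> //.
exact: term_order_refl.
Qed.

Lemma mem_psi p : inJ p <-> inJ (psi p).
Proof.
apply/ideal_gen_congr/subst_var_congr; rewrite subr0.
exact: initial_b0.
Qed.

Lemma mem_merge_var m : J 'X_[m] -> J 'X_[merge_var b0 b1 m].
Proof.
move=> /mem_phi; rewrite subst_varNX => /(ideal_genZ ((-1) ^+ m b0)).
by rewrite scalerA -expr2 sqrr_sign scale1r.
Qed.

(** The property [P] below passes to sums and multiples, so it suffices to check it on generators of
    [J]: [phi] kills [b0 + b1] and sends each monomial of [I] to a signed monomial of [J]. *)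
Lemma mem_msupp_phi p m : J p -> m \in msupp (phi p) -> J 'X_[m].
Proof.
pose P (p : {mpoly k[n]}) := forall m, m \in msupp (phi p) -> J 'X_[m].
have P0 : P 0 by move=> ?; rewrite rmorph0 msupp0.
have PD p1 p2 : P p1 -> P p2 -> P (p1 + p2).
  move=> P1 P2 m'; rewrite rmorphD /= => /msuppD_le.
  by rewrite mem_cat => /orP[/P1|/P2].
have PM c p1 : P p1 -> P (c * p1).
  move=> P1 m'; rewrite rmorphM /= => /msuppM_le.
  move=> /allpairsP[[m1 m2] /= [_ m2p ->]].
  by rewrite mpolyXD; apply/ideal_genM/P1.
suff PJ : forall q, J q -> P q by move=> /PJ; apply.
apply: (ideal_gen_ind (P := P)) => // q [Iq|->]; last first.
  move=> m'; rewrite rmorphD /= !subst_varXU eqxx (negPf b1_neq_b0).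
  by rewrite addNr msupp0.
have [M defI] := monI.
have MJ m1 : M m1 -> J 'X_[m1].
  move=> Mm1; apply: ideal_gen_sub; left; apply/defI/ideal_gen_sub.
  by exists m1.
move: Iq => /defI; apply: (ideal_gen_ind (P := P)) => // {}q [m1 Mm1 ->] m'.
rewrite subst_varNX => /msuppZ_le; rewrite msuppX inE => /eqP->.
exact/mem_merge_var/MJ.
Qed.

(** The coefficient of [m] survives [phi] because no other monomial of [p] is merged into [m]. *)
Lemma lead_mon_phi p m :
  is_lead_mon le p m -> m b0 = 0%N -> m \in msupp (phi p).
Proof.
move=> [mp lem] m0.
suff pm : p@_m = (phi p)@_m by rewrite mcoeff_msupp -pm -mcoeff_msupp.
rewrite {1 2}[p]mpolyE rmorph_sum !raddf_sum /=; apply: eq_big_seq => m' m'p.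
rewrite mcoeffZ linearZ /= mcoeffZ subst_varNX mcoeffZ !mcoeffX; congr (_ * _).
have [->|m'm] := eqVneq m' m.
  by rewrite m0 mul1r /merge_var m0 !mulm0n subm0 addm0 eqxx.
case: eqP => [mE|_]; last by rewrite mulr0.
(* If [m'] merges into [m], then [m] is at most [m']; but [m'] is at most the leading monomial
   [m]. *)
case/eqP: m'm; apply: (term_order_anti leP).
by rewrite lem //= -[X in le X m']mE le_merge_var.
Qed.

Lemma mem_initial_free h :
  phi h = h -> psi h = h -> J h <-> inJ h.
Proof.
move=> phi_h psi_h; split=> [Jh | inJh].
  (* Each monomial of [h] lies in [J] and is its own leading monomial. *)
  apply: ideal_gen_msupp => m mh; apply: ideal_gen_sub.
  exists 'X_[m], m; split=> //.
    by apply: (mem_msupp_phi Jh); rewrite phi_h.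
  split=> [|m']; rewrite msuppX inE ?eqxx // => /eqP->; exact: term_order_refl.
(* Elements of [inJ] met in the induction may involve [b0] and lie outside [J], so the claim carried
   along is that their image under [psi] is in [J]. *)
rewrite -psi_h; elim/ideal_gen_ind: inJh {phi_h psi_h}.
- by rewrite rmorph0; apply: ideal_gen0.
- by move=> p q Jp Jq; rewrite rmorphD; apply: ideal_genD.
- by move=> c p Jp; rewrite rmorphM; apply: ideal_genM.
move=> _ [p [m [Jp lead_m ->]]]; have [m0|m0] := eqVneq (m b0) 0%N.
  by rewrite subst_varX_free //; apply/(mem_msupp_phi Jp)/lead_mon_phi.
by rewrite subst_var0X //; apply: ideal_gen0.
Qed.

Lemma mem_phi_psi p :
  (J (phi p) <-> inJ (phi p)) /\ (J (psi p) <-> inJ (psi p)).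
Proof.
have phiV : phi (- 'X_b1) = - 'X_b1.
  by rewrite rmorphN /= subst_varXU (negPf b1_neq_b0).
have psiV : psi (- 'X_b1) = - 'X_b1.
  by rewrite rmorphN /= subst_varXU (negPf b1_neq_b0).
by split; apply: mem_initial_free; apply: subst_var_idem; rewrite ?rmorph0.
Qed.

Lemma regular_on_initial f :
  phi f = f -> psi f = f -> regular_on J f <-> initially_regular_on le J f.
Proof.
move=> phi_f psi_f; split=> -[mf reg]; split=> // g.
  (* Replace [g] by [psi g]: then [f * psi g] is fixed by both substitutions, so its membership
     transfers to [J], where [f] cancels, and [psi g] transfers back. *)
  move=> /mem_psi; rewrite rmorphM /= psi_f => fg.
  apply/mem_psi/(proj2 (mem_phi_psi g)).1/reg.
  by rewrite -psi_f -rmorphM; apply/(proj2 (mem_phi_psi _));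
    rewrite rmorphM /= psi_f.
(* The same argument with [phi g], from [J] to [inJ] and back. *)
move=> /mem_phi; rewrite rmorphM /= phi_f => fg.
apply/mem_phi/(proj1 (mem_phi_psi g))/reg.
by rewrite -phi_f -rmorphM; apply/(proj1 (mem_phi_psi _));
    rewrite rmorphM /= phi_f.
Qed.

End TwoVariables.

(** The variable added by [mwiden] is the last one, which is [b0] in the theorem, and its exponent
    is zero in every widened monomial. *)
Lemma subst_var_mwiden (k : fieldType) n (u : {mpoly k[n.+1]}) f :
  subst_var ord_max u (mwiden f) = mwiden f.
Proof.
rewrite [f]mpolyE [mwiden _]raddf_sum rmorph_sum /=; apply: eq_bigr => m _.
by rewrite mwidenZ mwidenX linearZ /= subst_varX_free // mnmwiden_ordmax.
Qed.

Theorem theorem2p5 (k : fieldType) (r : nat)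
    (I : {mpoly k[r.+2]} -> Prop) (monI : monomial_ideal I) (properI : ~ I 1)
    (le : rel 'X_{1..r.+2}) (leP : term_order le)
    (b1_lt_b0 : le U_(var_b1 r)%MM U_(var_b0 r)%MM /\
                U_(var_b1 r)%MM != U_(var_b0 r)%MM :> 'X_{1..r.+2})
    (f : {mpoly k[r.+1]}) :
  regular_on (ideal_add I ('X_(var_b0 r) + 'X_(var_b1 r))) (mwiden f) <->
  initially_regular_on le
    (ideal_add I ('X_(var_b0 r) + 'X_(var_b1 r))) (mwiden f).
Proof.
have [le_b1_b0 b1_neq_b0] := b1_lt_b0.
apply: regular_on_initial => //; try exact: subst_var_mwiden.
by apply: contraNneq b1_neq_b0 => ->.
Qed.
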